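(* Let $n \geq 3$ and $d \geq 2$, and let $V(n,d)$ be the number of vertices of $\Omega_n^d$. Then $$V(n,d) \leq \binom{n^d - \lfloor \frac{(n-1)^d+1}{2} \rfloor}{n^d - (n-1)^d} + \binom{n^d - \lfloor \frac{(n-1)^d+2}{2} \rfloor}{n^d - (n-1)^d}.$$
   Context: For integers $n,d \geq 1$ let $I_n^d = \{\alpha = (\alpha_1,\ldots,\alpha_d) : \alpha_i \in \{1,\ldots,n\}\}$. A $d$-dimensional matrix of order $n$ is an array $A = (a_\alpha)_{\alpha \in I_n^d}$ of real numbers, viewed as a point of $\mathbb{R}^{n^d}$. A line of $A$ is the set of entries obtained by fixing all but one coordinate of the index and letting the remaining coordinate range over $\{1,\ldots,n\}$. A matrix is polystochastic if all its entries are nonnegative and the sum of entries in each line equals $1$. $\Omega_n^d$ denotes the convex polytope of all $d$-dimensional polystochastic matrices of order $n$; a vertex of $\Omega_n^d$ is an extreme point of it. *)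

(* Defs.v *)
From HB Require Import structures.
From mathcomp Require Import all_boot all_order all_algebra.
From mathcomp Require Import reals.
Set Implicit Arguments. Unset Strict Implicit. Unset Printing Implicit Defensive.
Import Order.TTheory GRing.Theory Num.Theory.
Local Open Scope ring_scope.

(* Multi-indices alpha in I_n^d (coordinates shifted to 0..n-1). *)
Definition index (n d : nat) := {ffun 'I_d -> 'I_n}.

Definition dmatrix (R : realType) (n d : nat) := {ffun index n d -> R}.

Definition set_coord (n d : nat) (alpha : index n d) (k : 'I_d) (i : 'I_n)
  : index n d := [ffun j => if j == k then i else alpha j].

Definition polystochastic (R : realType) (n d : nat) (A : dmatrix R n d) : Prop :=
  (forall alpha, 0 <= A alpha) /\
  (forall (alpha : index n d) (k : 'I_d), \sum_(i < n) A (set_coord alpha k i) = 1).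

Definition is_vertex (R : realType) (n d : nat) (A : dmatrix R n d) : Prop :=
  polystochastic A /\
  forall (B C : dmatrix R n d) (t : R),
    polystochastic B -> polystochastic C -> 0 < t -> t < 1 ->
    (forall alpha, A alpha = t * B alpha + (1 - t) * C alpha) ->
    B = A /\ C = A.

(* Main.v *)
(** Polystochastic matrices form a slice of the nonnegative orthant of R^N,
    N = n^d, by an affine space of dimension D = (n-1)^d.  At a vertex v choose D
    coordinates J, all vanishing at v, that parametrize this affine space.  A
    linear cost with distinct values on the vertices then reads
    c(x) = c(v) + sum_(j in J) r_j x_j.  If another vertex w vanishes on
    A_v = {j : r_j < 0}, then c(w) >= c(v); hence c(w) < c(v) forces A_v to meet the
    complement B_w of J_w, which has N - D elements, while A_v and B_v are
    disjoint.  The skew version of Bollobas' theorem bounds the number of vertices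
    with #|A_v| <= p by C(p + N - D, p).  Every vertex has at most D/2 negative or
    at most (D-1)/2 positive reduced costs (rounded down), and the positive case
    is the negative one for -c.  (Compare Alon and Kalai's proof of the upper
    bound theorem; no perturbation to a simple polytope is needed here.) *)

Require Import Defs.
From HB Require Import structures.
From mathcomp Require Import all_boot all_order all_algebra.
From mathcomp Require Import reals.
From mathcomp Require Import zify ring lra.

Set Implicit Arguments.
Unset Strict Implicit.
Unset Printing Implicit Defensive.

Import Order.TTheory GRing.Theory Num.Theory.
Local Open Scope ring_scope.

(** * Skew Bollobas theorem by the polynomial method *)

(** In a vanishing combination of rows, take the index [j] of least key with nonzero coefficient:
    column [j] retains only its diagonal term. *)
Lemma row_free_key_triangular (F : fieldType) (disp : Order.disp_t)
    (K : orderType disp) (m : nat) (key : 'I_m -> K) (M : 'M[F]_m) :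
  injective key -> (forall i, M i i != 0) ->
  (forall i j, (key j < key i)%O -> M i j = 0) -> row_free M.
Proof.
move=> key_inj Mii Mij; apply: inj_row_free => u uM0; apply/eqP/negPn/negP.
case/rV0Pn=> i0 ui0.
case: (arg_minP (P := fun i => u 0 i != 0) key ui0) => j uj jmin.
have /rowP/(_ j)/eqP := uM0; rewrite !mxE (bigD1 j) //= big1 ?addr0; last first.
  move=> i neq_ij; have [->|ui] := eqVneq (u 0 i) 0; first by rewrite mul0r.
  by rewrite Mij ?mulr0 // lt_neqAle (inj_eq key_inj) eq_sym neq_ij jmin.
by rewrite mulf_eq0 (negbTE uj) (negbTE (Mii j)).
Qed.

(* Expanding each product of evaluations gives coefficient monomials indexed
   by maps from 'I_p to 'I_q.+1; such a monomial only depends on the sorted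
   sequence of values of the map, so the matrix factors through the space
   spanned by sorted p-tuples. *)
Lemma rank_prod_horner (F : fieldType) (m p q : nat)
    (x : 'I_m -> 'I_p -> F) (P : 'I_m -> {poly F}) :
  (forall j, size (P j) <= q.+1)%N ->
  (\rank (\matrix_(i < m, j < m) \prod_(l < p) (P j).[x i l])%R <= 'C(p + q, p))%N.
Proof.
move=> sizeP; pose S := [set t : p.-tuple 'I_q.+1 | sorted leq (map val t)].
pose srt (f : {ffun 'I_p -> 'I_q.+1}) : p.-tuple 'I_q.+1 :=
  sort_tuple (relpre val leq) [tuple f l | l < p].
have srtS f : srt f \in S.
  by rewrite inE sorted_map sort_sorted // => a b; apply: leq_total.
pose C := \matrix_(i < m, s < #|S|)
  \sum_(f | srt f == enum_val s) \prod_l x i l ^+ f l.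
pose Y := \matrix_(s < #|S|, j < m) \prod_(k <- enum_val s) (P j)`_k.
suff -> : \matrix_(i < m, j < m) \prod_(l < p) (P j).[x i l] = C *m Y.
  by rewrite -card_sorted_tuples mulmx_max_rank.
apply/matrixP => i j; rewrite !mxE.
under eq_bigr => l _ do rewrite (horner_coef_wide _ (sizeP j)).
rewrite bigA_distr_bigA (partition_big srt (fun s => s \in S)) //= big_enum_val.
apply: eq_bigr => s _; rewrite !mxE mulr_suml; apply: eq_bigr => f /eqP <-.
rewrite big_split mulrC; congr (_ * _).
rewrite (perm_big [tuple f l | l < p]) /=; last by rewrite perm_sort.
by rewrite big_map big_enum.
Qed.

(** The roots of [P j] are the [t e] with [e] in [B j], so entry [i, j] is zero exactly when [A i]
    meets [B j]. The matrix is thus triangular for [key], and its rank [m] is bounded by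
    [rank_prod_horner]. *)
Lemma skew_bollobas (disp : Order.disp_t) (K : orderType disp) (T : finType)
    (m p q : nat) (key : 'I_m -> K) (A B : 'I_m -> {set T}) :
  injective key ->
  (forall i, #|A i| <= p)%N -> (forall i, #|B i| <= q)%N ->
  (forall i, [disjoint A i & B i]) ->
  (forall i j, (key j < key i)%O -> ~~ [disjoint A i & B j]) ->
  (m <= 'C(p + q, p))%N.
Proof.
move=> key_inj cardA cardB disjAB meetAB.
pose t (e : T) : rat := (enum_rank e).+1%:R.
have t_inj : injective t.
  by move=> a b /(mulrIn (oner_neq0 _)) [] /val_inj /enum_rank_inj.
pose P j : {poly rat} := \prod_(e <- enum (B j)) ('X - (t e)%:P).
(* The junk value 0 of nth pads A i with points that are not of the form t e. *)
pose x i (l : 'I_p) := nth 0 [seq t e | e <- enum (A i)] l.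
have sizeP j : (size (P j) <= q.+1)%N.
  by rewrite size_prod_XsubC -cardE ltnS.
have rootP j y : (P j).[y] = 0 -> exists2 e, e \in B j & y = t e.
  rewrite horner_prod => /eqP; rewrite prodf_seq_eq0 => /hasP[e].
  by rewrite mem_enum hornerXsubC subr_eq0 /= => Be /eqP; exists e.
have := rank_prod_horner x sizeP; set M := \matrix_(_, _) _.
suff /eqP -> : row_free M by [].
apply: (row_free_key_triangular key_inj) => [i|i j /meetAB].
  rewrite mxE prodf_seq_neq0; apply/allP => l _ /=; apply/negP => /eqP /rootP[e Be].
  have [lA|lA] := ltnP l (size (enum (A i))); last first.
    rewrite /x nth_default ?size_map // => /esym/eqP.
    by rewrite pnatr_eq0.
  rewrite /x (nth_map e) // => /t_inj eqe.
  have := disjointFr (disjAB i) (x := e); rewrite -{1}eqe -mem_enum mem_nth //.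
  by rewrite Be => /(_ isT).
case/pred0Pn => e /andP[/= Ae Be]; rewrite mxE.
have lp : (index e (enum (A i)) < p)%N.
  by apply: leq_trans (cardA i); rewrite cardE index_mem mem_enum.
apply/eqP; rewrite prodf_seq_eq0; apply/hasP; exists (Ordinal lp) => //=.
  by rewrite mem_index_enum.
rewrite /x (nth_map e) ?index_mem ?mem_enum //= nth_index ?mem_enum //.
rewrite horner_prod prodf_seq_eq0; apply/hasP; exists e; first by rewrite mem_enum.
by rewrite hornerXsubC subrr /=.
Qed.

(** * Separating functionals, reduced costs and the count of basic points *)

Lemma exists_nonroot (F : numFieldType) (p : {poly F}) :
  p != 0 -> exists t, ~~ root p t.
Proof.
move=> p0; pose s := [seq k%:R : F | k <- iota 0 (size p)].
have us : uniq s.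
  by rewrite map_inj_in_uniq ?iota_uniq // => a b _ _ /(mulrIn (oner_neq0 _)).
have [allr|/allPn[t _ rt]] := boolP (all (root p) s); last by exists t.
by have := max_poly_roots p0 allr us; rewrite size_map size_iota ltnn.
Qed.

(** For [c = (1, t, t^2, ...)], equal values at [x i] and [x j] make [t] a root of the polynomial
    with coefficients [x i - x j]. *)
Lemma exists_separating_functional (F : numFieldType) (m N : nat)
    (x : 'I_m -> 'rV[F]_N) :
  injective x -> exists c : 'cV[F]_N, injective (fun i => (x i *m c) 0 0).
Proof.
move=> x_inj.
pose p := \prod_(ij : 'I_m * 'I_m | ij.1 != ij.2) rVpoly (x ij.1 - x ij.2).
have /exists_nonroot[t] : p != 0.
  apply/prodf_neq0 => -[i j] /= neq_ij.
  apply: contra_neq neq_ij => /(congr1 (poly_rV (d := N))).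
  by rewrite rVpolyK linear0 => /subr0_eq /x_inj.
move=> rpt; exists (\col_k t ^+ k) => i j /= eqij; apply/eqP/negPn/negP => neq_ij.
case/negP: rpt; rewrite /root horner_prod prodf_seq_eq0; apply/hasP.
exists (i, j); first by rewrite mem_index_enum.
rewrite /= neq_ij /= (horner_coef_wide _ (size_poly _ _)).
under eq_bigr => k _ do rewrite coef_rVpoly_ord.
apply/eqP; have : (x i - x j) *m (\col_k t ^+ k) = 0.
  apply/matrixP => a b; rewrite !ord1 mulmxBl mxE [X in _ + X]mxE.
  by apply/eqP; rewrite [X in _ == X]mxE subr_eq0; apply/eqP.
move=> /matrixP/(_ 0 0); rewrite !mxE => eq0; rewrite -[RHS]eq0.
by apply: eq_bigr => k _; rewrite !mxE.
Qed.

(** By hypothesis the columns of [E] at the zeros of [v] have rank [D]. If [J] picks [D] independent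
    ones, [z = u *m E] is determined by its [J]-coordinates. *)
Lemma exists_reduced_costs (F : fieldType) (D N : nat) (E : 'M[F]_(D, N))
    (v : 'rV[F]_N) :
  (forall u : 'rV_D, (forall k, v 0 k = 0 -> (u *m E) 0 k = 0) -> u = 0) ->
  exists2 J : 'I_D -> 'I_N, injective J /\ (forall l, v 0 (J l) = 0) &
    forall c : 'cV[F]_N, exists r : 'I_D -> F, forall z : 'rV_N,
      (z <= E)%MS -> (z *m c) 0 0 = \sum_l r l * z 0 (J l).
Proof.
move=> vE; pose Z := [set k | v 0 k == 0].
have freeZ : row_free (colsub (enum_val : 'I_#|Z| -> _) E).
  apply: inj_row_free => u; rewrite mulmx_colsub => uE0; apply: vE => k vk0.
  have Zk : k \in Z by rewrite inE vk0.
  by have /rowP/(_ (enum_rank_in Zk k)) := uE0; rewrite !mxE enum_rankK_in.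
have fullZ : row_full (colsub (enum_val : 'I_#|Z| -> _) E)^T.
  by rewrite /row_full mxrank_tr.
pose J l := enum_val (fullrankfun fullZ l).
have JU : colsub J E \in unitmx.
  have := fullrowsub_unit fullZ; rewrite -unitmx_tr; congr (_ \in unitmx).
  by apply/matrixP => i j; rewrite !mxE.
exists J; first split.
- by move=> a b /enum_val_inj /fullrankfun_inj.
- by move=> l; have := enum_valP (fullrankfun fullZ l); rewrite inE => /eqP.
move=> c; exists (fun l => (invmx (colsub J E) *m (E *m c)) l 0) => _ /submxP[u ->].
rewrite -[u in LHS](mulmxK JU) -!mulmxA mulmxA mulmx_colsub mxE.
by apply: eq_bigr => l _; rewrite [in LHS]mxE mulrC.
Qed.

(* The last hypothesis says that x i is a vertex of the slice of the orthant by
   x i + <E>: no nonzero direction of E is supported on the support of x i. *)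
Lemma upper_bound_basic_points (F : realFieldType) (m D N : nat)
    (E : 'M[F]_(D, N)) (x : 'I_m -> 'rV[F]_N) :
  (0 < D)%N -> injective x -> (forall i k, 0 <= x i 0 k) ->
  (forall i j, (x i - x j <= E)%MS) ->
  (forall i (u : 'rV_D),
    (forall k, x i 0 k = 0 -> (u *m E) 0 k = 0) -> u = 0) ->
  (m <= 'C(N - D.+1./2, N - D) + 'C(N - D.+2./2, N - D))%N.
Proof.
move=> D0 x_inj x_ge0 xE xv.
have [J [J_inj xJ] costs] : exists2 J : 'I_m -> 'I_D -> 'I_N,
    (forall i, injective (J i)) /\ (forall i l, x i 0 (J i l) = 0) &
    forall i (c : 'cV[F]_N), exists r : 'I_D -> F, forall z : 'rV_N,
      (z <= E)%MS -> (z *m c) 0 0 = \sum_l r l * z 0 (J i l).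
  have [J HJ costs] := fin_all_exists2 (fun i => exists_reduced_costs (xv i)).
  by exists J => //; split=> i; case: (HJ i).
have half (c : 'cV[F]_N) (r : 'I_m -> 'I_D -> F) p :
    injective (fun i => (x i *m c) 0 0) ->
    (forall i (z : 'rV_N), (z <= E)%MS -> (z *m c) 0 0 = \sum_l r i l * z 0 (J i l)) ->
    (#|[set i | #|[set l | (r i l < 0)%R]| <= p]| <= 'C(p + (N - D), p))%N.
  move=> c_inj rE; set S := [set i | _].
  pose A i := [set J i l | l in [set l | r i l < 0]].
  pose B i := ~: [set J i l | l : 'I_D].
  pose e : 'I_#|S| -> 'I_m := enum_val.
  apply: (skew_bollobas (key := fun i => (x (e i) *m c) 0 0) (A := A \o e)
            (B := B \o e)) => [i j /c_inj/enum_val_inj//|i|i|i|i j /=].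
  - by rewrite card_imset //; have := enum_valP i; rewrite inE.
  - rewrite -(leq_add2l #|[set J (e i) l | l : 'I_D]|) cardsC card_ord.
    by rewrite card_imset // card_ord -leq_subLR.
  - rewrite -subsets_disjoint; apply/subsetP => _ /imsetP[l _ ->].
    by rewrite imset_f.
  (* If [A (e i)] lies in the image of [J (e j)], then [x (e j)] vanishes on it, and only
     nonnegative terms remain in the cost difference. *)
  rewrite -subr_gt0; apply: contraL; rewrite -subsets_disjoint -leNgt => /subsetP AB.
  have -> : (x (e i) *m c) 0 0 - (x (e j) *m c) 0 0
          = - (((x (e j) - x (e i)) *m c) 0 0).
    by rewrite mulmxBl !mxE opprB.
  rewrite oppr_le0 (rE (e i)) //; apply: sumr_ge0 => l _; rewrite !mxE xJ subr0.
  have [r_ge0|r_lt0] := leP 0 (r (e i) l); first exact: mulr_ge0.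
  have /AB/imsetP[l' _ ->] : J (e i) l \in A (e i) by rewrite imset_f ?inE.
  by rewrite xJ mulr0.
have [->//|m0] := posnP m.
have leDN : (D <= N)%N.
  by rewrite -(card_ord D) -(card_ord N) (leq_card _ (J_inj (Ordinal m0))).
have [c c_inj] := exists_separating_functional x_inj.
have [r rE] := fin_all_exists (fun i => costs i c).
have halfP := half c r D./2 c_inj rE.
(* As [0 < D], the number [D - D.+2./2] is [(D - 1) / 2] rounded down. *)
have halfN : (#|[set i | #|[set l | (0 < r i l)%R]| <= D - D.+2./2]|
    <= 'C(D - D.+2./2 + (N - D), D - D.+2./2))%N.
  have := half (- c) (fun i l => - r i l) (D - D.+2./2)%N.
  under eq_finset => i do under eq_finset => l do rewrite oppr_lt0.
  have oppE (M : 'M[F]_1) : (- M) 0 0 = - M 0 0 by rewrite mxE.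
  apply=> [i j|i z zE]; first by rewrite !mulmxN !oppE => /oppr_inj/c_inj.
  rewrite mulmxN oppE (rE i) // -sumrN; apply: eq_bigr => l _.
  by rewrite mulNr.
have := leq_add halfP halfN; rewrite -!(bin_sub (leq_addr _ _)) !addKn.
have -> : (D./2 + (N - D) = N - D.+1./2)%N by lia.
have -> : (D - D.+2./2 + (N - D) = N - D.+2./2)%N by lia.
apply: leq_trans; apply: leq_trans (leq_card_setU _ _).
rewrite -[m in (m <= _)%N]card_ord -cardsT; apply/subset_leq_card/subsetP => i _.
rewrite !inE; have [//|neg_gt] := leqP; rewrite orFb.
have disj : [disjoint [set l | r i l < 0] & [set l | 0 < r i l]].
  by rewrite disjoint_subset; apply/subsetP => l; rewrite !inE -leNgt => /ltW.
have := max_card (mem ([set l | r i l < 0] :|: [set l | 0 < r i l])).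
rewrite card_ord cardsU (disjoint_setI0 disj) cards0 subn0; lia.
Qed.

(** * Arrays with zero line sums *)

(* Row b of this n x n.+1 matrix is e_b - e_n; its d-th tensor power, line_kernel,
   spans the arrays all of whose line sums vanish. *)
Definition ext_coef (R : pzRingType) (n : nat) (b : 'I_n) (a : 'I_n.+1) : R :=
  if unlift ord_max a is Some b' then (b' == b)%:R else -1.

Lemma sum_ext_coef (R : pzRingType) (n : nat) (b : 'I_n) :
  \sum_a ext_coef R b a = 0.
Proof.
rewrite (bigD1_ord ord_max) //= /ext_coef unlift_none.
under eq_bigr => a _ do rewrite liftK.
by rewrite (bigD1 b) //= eqxx big1 ?addr0 ?addNr // => a /negbTE ->.
Qed.

Definition lift_index (n d : nat) (beta : Defs.index n d) : Defs.index n.+1 d :=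
  [ffun k => lift ord_max (beta k)].

Definition line_kernel (R : pzRingType) (n d : nat) :=
  \matrix_(b < #|Defs.index n d|, a < #|Defs.index n.+1 d|)
    \prod_k ext_coef R ((enum_val b : Defs.index n d) k)
                       ((enum_val a : Defs.index n.+1 d) k).

(** The columns at lifted indices form an identity matrix. *)
Lemma line_kernel_lift (R : comPzRingType) (n d : nat) (u : 'rV[R]_#|Defs.index n d|)
    (beta : Defs.index n d) :
  (u *m line_kernel R n d) 0 (enum_rank (lift_index beta)) = u 0 (enum_rank beta).
Proof.
rewrite mxE (bigD1 (enum_rank beta)) //= big1 ?addr0 => [|b neq_b].
  rewrite mxE !enum_rankK big1 ?mulr1 // => k _.
  by rewrite /ext_coef ffunE liftK eqxx.
rewrite mxE enum_rankK.
have [k neq_k|eq_b] := pickP (fun k => beta k != (enum_val b : Defs.index n d) k).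
  by rewrite (bigD1 k) //= /ext_coef ffunE liftK (negbTE neq_k) mul0r mulr0.
case/negP: neq_b; rewrite -(can_eq enum_valK) enum_rankK; apply/eqP/ffunP => k.
by apply/esym/eqP; move/(_ k)/negbFE: eq_b.
Qed.

Lemma line_kernel_line_sum (R : comPzRingType) (n d : nat)
    (u : 'rV[R]_#|Defs.index n d|) (alpha : Defs.index n.+1 d) (k : 'I_d) :
  \sum_i (u *m line_kernel R n d) 0 (enum_rank (set_coord alpha k i)) = 0.
Proof.
under eq_bigr => i _ do rewrite mxE.
rewrite exchange_big big1 // => b _; rewrite -mulr_sumr.
suff -> : \sum_i line_kernel R n d b (enum_rank (set_coord alpha k i)) = 0.
  by rewrite mulr0.
under eq_bigr => i _ do rewrite mxE enum_rankK (bigD1 k) //= ffunE eqxx.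
under eq_bigr => i _ do under eq_bigr => j neq_jk do rewrite ffunE (negbTE neq_jk).
by rewrite -mulr_suml sum_ext_coef mul0r.
Qed.

(** Induction on the number of coordinates equal to [ord_max]: the line in the direction of such a
    coordinate gives the entry in terms of entries with fewer of them. *)
Lemma zero_line_sums_eq0 (R : nmodType) (n d : nat) (z : Defs.index n.+1 d -> R) :
  (forall alpha k, \sum_i z (set_coord alpha k i) = 0) ->
  (forall beta, z (lift_index beta) = 0) -> forall alpha, z alpha = 0.
Proof.
move=> line0 lift0 alpha.
have [m] := ubnP #|[set k | alpha k == ord_max]|.
elim: m alpha => // m IH alpha; rewrite ltnS => le_m.
have [k /eqP ak|no_max] := pickP (fun k => alpha k == ord_max).
  have := line0 alpha k; rewrite (bigD1_ord ord_max) //= big1 => [|i _].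
    rewrite addr0; suff -> : set_coord alpha k ord_max = alpha by [].
    by apply/ffunP => j; rewrite ffunE; case: eqP => // ->.
  apply: IH; apply: leq_trans le_m; apply/proper_card/properP; split.
    apply/subsetP => j; rewrite !inE ffunE; have [->|//] := eqVneq j k.
    by rewrite ak.
  exists k; rewrite !inE ?ak // ffunE eqxx eq_sym.
  exact: neq_lift.
suff [beta ->] : exists beta, alpha = lift_index beta by [].
have /fin_all_exists[beta betaE] k : exists b, alpha k = lift ord_max b.
  by case: (unliftP ord_max (alpha k)) (no_max k) => [b ->|->]; [exists b | rewrite eqxx].
by exists (finfun beta); apply/ffunP => k; rewrite !ffunE.
Qed.

Lemma sub_line_kernel (F : fieldType) (n d : nat) (z : 'rV[F]_#|Defs.index n.+1 d|) :
  (forall (alpha : Defs.index n.+1 d) k,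
    \sum_i z 0 (enum_rank (set_coord alpha k i)) = 0) ->
  (z <= line_kernel F n d)%MS.
Proof.
move=> line0.
pose u : 'rV_#|Defs.index n d| :=
  \row_b z 0 (enum_rank (lift_index (enum_val b))).
apply/submxP; exists u; apply/eqP; rewrite -subr_eq0; apply/eqP/rowP => a.
rewrite [RHS]mxE -[a]enum_valK.
apply: (zero_line_sums_eq0 (z := fun a => (z - u *m line_kernel F n d) 0 (enum_rank a))).
  move=> alpha k; under eq_bigr => i _ do rewrite mxE [X in _ + X]mxE.
  by rewrite sumrB line0 line_kernel_line_sum subrr.
by move=> beta; rewrite mxE [X in _ + X]mxE line_kernel_lift mxE enum_rankK subrr.
Qed.

(** * Vertices of the polystochastic polytope *)

Lemma exists_small_step (F : realFieldType) (T : finType) (a z : T -> F) :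
  (forall k, 0 <= a k) -> (forall k, a k = 0 -> z k = 0) ->
  exists2 e, 0 < e & forall k, e * `|z k| <= a k.
Proof.
move=> a_ge0 az; pose g k := if z k == 0 then 1 else a k / `|z k|.
exists (\big[Num.min/1]_k g k).
  apply: lt_bigmin => // k _; rewrite /g; case: eqVneq => // zk.
  rewrite divr_gt0 ?normr_gt0 // lt_neqAle a_ge0 andbT eq_sym.
  by apply: contra_neq zk => /az.
move=> k; have [->|zk] := eqVneq (z k) 0; first by rewrite normr0 mulr0.
by rewrite -ler_pdivlMr ?normr_gt0 // (bigmin_inf k) // /g (negbTE zk).
Qed.

(** For small [e > 0], [A] is the midpoint of the polystochastic matrices [A + e Z] and
    [A - e Z]. *)
Lemma vertex_support (R : realType) (n d : nat) (A : dmatrix R n d)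
    (Z : dmatrix R n d) :
  is_vertex A -> (forall alpha k, \sum_i Z (set_coord alpha k i) = 0) ->
  (forall alpha, A alpha = 0 -> Z alpha = 0) -> forall alpha, Z alpha = 0.
Proof.
move=> [[A_ge0 A_line] A_extreme] Z_line AZ alpha.
have [e e_gt0 eZ] := exists_small_step A_ge0 AZ.
have poly (s : R) : `|s| = e -> polystochastic [ffun a => A a + s * Z a].
  move=> s_e; split=> [a|a k].
    rewrite ffunE -lerBlDl sub0r lerNl; apply: le_trans (eZ a).
    by rewrite -s_e -normrM -normrN ler_norm.
  under eq_bigr => i _ do rewrite ffunE.
  by rewrite big_split /= -mulr_sumr A_line Z_line mulr0 addr0.
have e_ge0 := ltW e_gt0.
have [| | | | |/ffunP/(_ alpha) + _] :=
    A_extreme [ffun a => A a + e * Z a] [ffun a => A a + - e * Z a] (1 / 2).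
- by apply: poly; rewrite ger0_norm.
- by apply: poly; rewrite normrN ger0_norm.
- by lra.
- by lra.
- by move=> a; rewrite !ffunE; field.
rewrite ffunE => /eqP; rewrite -subr_eq0 addrC addKr mulf_eq0 (gt_eqF e_gt0).
by move=> /eqP.
Qed.

(* Every duplicate-free list of vertices of Omega_n^d has length at most the
   bound; i.e. the vertex set is finite and V(n,d) <= bound. *)
Theorem theorem1 (R : realType) (n d : nat) :
  (3 <= n)%N -> (2 <= d)%N ->
  forall s : seq (dmatrix R n d),
    uniq s -> (forall A, A \in s -> is_vertex A) ->
    (size s <= 'C(n ^ d - ((n.-1) ^ d).+1./2, n ^ d - (n.-1) ^ d)
              + 'C(n ^ d - ((n.-1) ^ d).+2./2, n ^ d - (n.-1) ^ d))%N.
Proof.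
move=> n_ge3 d_ge2 s s_uniq s_vertex.
case: n n_ge3 s s_uniq s_vertex => // n n_ge2 s s_uniq s_vertex /=.
have cardI k : #|Defs.index k d| = (k ^ d)%N by rewrite card_ffun !card_ord.
pose A (i : 'I_(size s)) := tnth (in_tuple s) i.
have A_vertex i : is_vertex (A i) by apply: s_vertex; apply: mem_tnth.
pose x i : 'rV_#|Defs.index n.+1 d| := \row_k (A i) (enum_val k).
rewrite -!cardI.
apply: (@upper_bound_basic_points _ _ _ _ (line_kernel R n d) x).
- by rewrite cardI expn_gt0 -ltnS ltnW.
- move=> i j /rowP eq_x; apply: (tuple_uniqP (in_tuple s) s_uniq); apply/ffunP => a.
  by have := eq_x (enum_rank a); rewrite !mxE enum_rankK.
- by move=> i k; rewrite mxE; case: (A_vertex i) => -[].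
- move=> i j; apply: sub_line_kernel => a k.
  under eq_bigr => l _ do rewrite !mxE enum_rankK.
  rewrite sumrB; case: (A_vertex i) (A_vertex j) => -[_ Ai] _ [[_ Aj] _].
  by rewrite Ai Aj subrr.
move=> i u uE0; pose Z : dmatrix R n.+1 d :=
  [ffun a => (u *m line_kernel R n d) 0 (enum_rank a)].
have Z0 : forall a, Z a = 0.
  apply: (vertex_support (A_vertex i)) => [a k|a Aa0].
    by under eq_bigr => l _ do rewrite ffunE; apply: line_kernel_line_sum.
  by rewrite ffunE uE0 // mxE enum_rankK.
apply/rowP => b; rewrite mxE -[b]enum_valK -line_kernel_lift.
by have := Z0 (lift_index (enum_val b)); rewrite ffunE.
Qed.
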